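(* Let $J\in\mathbb{N}$, let $S_0<S_1<\dots<S_J$ be real numbers, and let $\Delta>0$ be such that the intervals $[S_j-\Delta,S_j+\Delta]$, $j\in\{0,1,\dots,J\}$, are pairwise disjoint. Let $(f_j,f_j',f_j'')\in\mathbb{R}^3$ for $j\in\{0,\dots,J\}$. For each $j\in\{0,\dots,J\}$ let $P_j$ be a polynomial of degree $9$ such that $P_j$, $\dot P_j$ and $\ddot P_j$ all vanish at $S_j-\Delta$ and at $S_j+\Delta$, and $P_j(S_j)=f_j$, $\dot P_j(S_j)=f_j'$, $\ddot P_j(S_j)=f_j''$ (such polynomials exist). Define $F_J:\mathbb{R}\to\mathbb{R}$ by $F_J(\theta)=P_j(\theta)$ for $\theta\in[S_j-\Delta,S_j+\Delta]$, $j=0,\dots,J$, and $F_J(\theta)=0$ otherwise. Then: (1) for all $j\in\{0,\dots,J\}$, $F_J(S_j)=f_j$, $\dot F_J(S_j)=f_j'$, $\ddot F_J(S_j)=f_j''$; (2) for all $j\in\{0,\dots,J\}$, $F_J(S_j-\Delta)=\dot F_J(S_j-\Delta)=\ddot F_J(S_j-\Delta)=F_J(S_j+\Delta)=\dot F_J(S_j+\Delta)=\ddot F_J(S_j+\Delta)=0$; (3) $F_J$ is bounded below, and $\dot F_J$ exists everywhere on $\mathbb{R}$ and is locally Lipschitz continuous.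
   Context: $\dot F,\ddot F$ denote first and second derivatives; $\mathbb{N}=\{1,2,\dots\}$. *)

(* Defs.v *)
From HB Require Import structures.
From mathcomp Require Import all_boot all_order all_algebra.
From mathcomp Require Import all_classical all_reals all_analysis.

Set Implicit Arguments.
Unset Strict Implicit.
Unset Printing Implicit Defensive.

Import Order.TTheory GRing.Theory Num.Theory.
Import numFieldNormedType.Exports.

Local Open Scope classical_set_scope.
Local Open Scope ring_scope.

(* F(x) = a, F'(x) = b and F''(x) = c, where the existence of the two
   derivatives at x is part of the assertion. *)
Definition jet2 (R : realType) (F : R -> R) (x a b c : R) : Prop :=
  [/\ F x = a, is_derive x (1 : R) F b & is_derive x (1 : R) F^`()%classic c].

(* MathComp's size is the degree plus one, so [size p = 10%N] is degree 9. *)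
Definition bump_poly (R : realType) (s Delta f f1 f2 : R) (p : {poly R})
  : Prop :=
  [/\ size p = 10%N,
      jet2 (horner p) (s - Delta) 0 0 0,
      jet2 (horner p) (s + Delta) 0 0 0
    & jet2 (horner p) s f f1 f2].

(* The index j chosen by [pick] is unique as soon as the intervals
   [S_j - Delta, S_j + Delta] are pairwise disjoint. *)
Definition bump_fun (R : realType) (J : nat) (s : 'I_J.+1 -> R) (Delta : R)
    (P : 'I_J.+1 -> {poly R}) (theta : R) : R :=
  if [pick j | theta \in `[s j - Delta, s j + Delta]] is Some j
  then (P j).[theta] else 0.

(* Main.v *)
Require Import Defs.
From HB Require Import structures.
From mathcomp Require Import all_boot all_order all_algebra.
From mathcomp Require Import all_classical all_reals all_analysis.
From mathcomp Require Import ring lra.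

Set Implicit Arguments.
Unset Strict Implicit.
Unset Printing Implicit Defensive.

Import Order.TTheory GRing.Theory Num.Theory.
Import numFieldNormedType.Exports.

Local Open Scope classical_set_scope.
Local Open Scope ring_scope.

(** Existence is Hermite interpolation made explicit.  A polynomial
    (u v) ^ 3 g with u = X - (s - Delta) and v = X - (s + Delta) vanishes to
    order three at both endpoints ([jet2_cube_root]); at the centre s the cube
    is nonzero, so the value and the first two derivatives there can be
    prescribed by the coefficients of order 0, 1 and 2 of g, expanded around s.
    Taking g monic cubic makes the degree exactly 9.

    For the second part, disjointness of the intervals turns the piecewise
    function into a finite sum of pieces, each a polynomial cut off to zero
    outside one interval ([bump_funE]), so every claim reduces to a single
    piece.  Cutting off commutes with differentiation as soon as the function
    and its derivative vanish at the endpoints ([is_derive_trunc]); this applies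
    to P_j, and again to its derivative because the second derivative vanishes
    at the endpoints too.  Hence the first and second derivatives of the
    piecewise function are the piecewise functions built from the derivatives
    of the P_j ([is_derive_bump_fun]), and all jets are read off from the
    polynomials.  These piecewise functions are bounded
    ([bump_fun_bounded]): for the function itself this gives the lower bound,
    and for its second derivative it makes the first derivative Lipschitz, by
    the mean value theorem; the constant is even global. *)

(** * Second-order jets of polynomials and the interpolation problem *)

Lemma jet2_horner (R : realType) (p : {poly R}) (x : R) :
  jet2 (horner p) x p.[x] p^`().[x] p^`()^`().[x].
Proof. by split=> //; rewrite -?derivE; exact: is_derive_poly. Qed.

(** Translates the analytic jet into formal derivatives, which makes all jet
    computations below purely algebraic. *)
Lemma jet2_hornerP (R : realType) (p : {poly R}) (x a b c : R) :
  jet2 (horner p) x a b c <->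
  [/\ p.[x] = a, p^`().[x] = b & p^`()^`().[x] = c].
Proof.
split=> [[pa pb pc]|[<- <- <-]]; last exact: jet2_horner.
have [_ qb qc] := jet2_horner p x.
by split=> //; [rewrite -(@derive_val _ _ _ _ _ _ _ qb)
               |rewrite -(@derive_val _ _ _ _ _ _ _ qc)]; exact: derive_val.
Qed.

(** By the product rule each of the first two derivatives of the product still
    has u as a factor, and u vanishes at x. *)
Lemma jet2_cube_root (R : realType) (u q : {poly R}) (x : R) :
  root u x -> jet2 (horner (u ^+ 3 * q)) x 0 0 0.
Proof.
move=> /rootP ux; apply/jet2_hornerP; rewrite !exprS expr0 mulr1.
by split; rewrite ?(derivM, derivD) ?(hornerM, hornerD) ux; ring.
Qed.

Lemma bump_poly_exists (R : realType) (s Delta f f1 f2 : R) :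
  0 < Delta -> exists p : {poly R}, bump_poly s Delta f f1 f2 p.
Proof.
move=> D0.
(* With y = X - s one has (u v)^3 = (y^2 - Delta^2)^3
   = - Delta^6 + 3 Delta^4 y^2 + O(y^4); dividing f + f1 y + f2 y^2 / 2 by it
   modulo y^3 gives A + B y + C y^2. *)
pose A : R := - f / Delta ^+ 6; pose B : R := - f1 / Delta ^+ 6.
pose C : R := (3 * Delta ^+ 4 * A - f2 / 2) / Delta ^+ 6.
pose u : {poly R} := 'X - (s - Delta)%:P.
pose v : {poly R} := 'X - (s + Delta)%:P.
pose y : {poly R} := 'X - s%:P.
pose g : {poly R} := y ^+ 3 + (C *: y ^+ 2 + B *: y + A%:P).
have sz_low : (size (C *: y ^+ 2 + B *: y + A%:P)%R < size (y ^+ 3)%R)%N.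
  rewrite size_exp_XsubC ltnS.
  rewrite (leq_trans (size_polyD _ _))// geq_max.
  rewrite (leq_trans (size_polyC_leq1 _))// andbT.
  rewrite (leq_trans (size_polyD _ _))// geq_max.
  rewrite !(leq_trans (size_scale_leq _ _))// ?size_XsubC//.
  by rewrite size_exp_XsubC.
have g_monic : g \is monic.
  by rewrite monicE /g lead_coefDl// -monicE monic_exp ?monicXsubC.
have uv_monic : (u * v) ^+ 3 \is monic.
  by rewrite monic_exp// monicMl ?monicXsubC.
exists ((u * v) ^+ 3 * g); split.
- rewrite size_monicM ?monic_neq0// /g size_polyDl// exprMn.
  rewrite size_monicM ?monic_neq0 ?monic_exp ?monicXsubC//.
  by rewrite !size_exp_XsubC.
- by apply: jet2_cube_root; rewrite rootM root_XsubC eqxx.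
- by apply: jet2_cube_root; rewrite rootM [root v _]root_XsubC eqxx orbT.
- apply/jet2_hornerP.
  have u_s : u.[s] = Delta by rewrite /u !hornerE; ring.
  have v_s : v.[s] = - Delta by rewrite /v !hornerE; ring.
  have y_s : y.[s] = 0 by rewrite /y !hornerE; ring.
  have du : u^`() = 1 by rewrite derivXsubC.
  have dv : v^`() = 1 by rewrite derivXsubC.
  have dy : y^`() = 1 by rewrite derivXsubC.
  rewrite /g !exprS !expr0 !mulr1; clear g sz_low g_monic uv_monic.
  (* From here on only the values and derivatives of u, v, y at s matter;
     keeping the bodies would let the evaluation rules expand them. *)
  clearbody u v y.
  split; rewrite ?(derivM, derivD, derivZ, derivC, du, dv, dy, deriv0);
    rewrite ?(hornerM, hornerD, hornerZ, hornerC);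
    rewrite u_s v_s ?y_s /C /B /A; field; rewrite ?gt_eqF//.
Qed.

(** * Truncating a function to an interval *)

Section Truncation.
Context {R : realType}.
Implicit Types (a b x : R) (f g dg : R -> R).

Definition trunc a b g x : R := if x \in `[a, b] then g x else 0.

(** The difference quotients of f at x are bounded in absolute value by those
    of g, so they tend to zero with them.  This serves the endpoints, where a
    truncation need not agree with a smooth function on a neighbourhood. *)
Lemma is_derive_dominated f g x :
  g x = 0 -> (forall y, `|f y| <= `|g y|) ->
  is_derive x (1 : R) g 0 -> is_derive x (1 : R) f 0.
Proof.
move=> gx fg [dg vg].
have fx : f x = 0.
  by apply/eqP; rewrite -normr_le0 (le_trans (fg x))// gx normr0.
have qg :
    (fun h => h^-1 *: ((g \o shift x) (h *: 1) - g x)) @ 0^' --> 'D_1 g x.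
  exact: dg.
suff qf : (fun h => h^-1 *: ((f \o shift x) (h *: 1) - f x)) @ 0^' --> (0 : R).
  by split; [apply/cvg_ex; exists 0|exact/cvg_lim].
rewrite vg in qg.
apply: norm_cvg0; move/(iffRL (norm_cvg0P _)): qg.
apply: (@squeeze_cvgr _ _ _ _ (cst 0)); last exact: cvg_cst.
by near=> h; rewrite normr_ge0 /= fx gx !subr0 !normrZ ler_wpM2l.
Unshelve. all: by end_near. Qed.

Lemma norm_trunc_le a b g x : `|trunc a b g x| <= `|g x|.
Proof. by rewrite /trunc; case: ifP; rewrite ?normr0. Qed.

(** Away from the endpoints the truncation is locally g or locally zero; at an
    endpoint it is dominated by g, which vanishes there with its derivative. *)
Lemma is_derive_trunc a b g dg x :
  (forall y, is_derive y (1 : R) g (dg y)) ->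
  g a = 0 -> g b = 0 -> dg a = 0 -> dg b = 0 ->
  is_derive x (1 : R) (trunc a b g) (trunc a b dg x).
Proof.
move=> g_dg ga gb dga dgb.
have at_zero z : g z = 0 -> dg z = 0 ->
    is_derive z (1 : R) (trunc a b g) (trunc a b dg z).
  move=> gz dgz.
  have -> : trunc a b dg z = 0 by rewrite /trunc dgz if_same.
  apply: (is_derive_dominated gz (norm_trunc_le a b g)).
  by rewrite -dgz.
have [->|xa] := eqVneq x a; first exact: at_zero.
have [->|xb] := eqVneq x b; first exact: at_zero.
rewrite /trunc; case: ifPn => [xab|xNab].
  have xoo : x \in `]a, b[.
    by move: xab; rewrite !in_itv/= !lt_neqAle eq_sym xa xb.
  apply: near_eq_is_derive (g_dg x).
  near=> y; have /subset_itv_oo_cc : y \in `]a, b[.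
    by near: y; exact: near_in_itvoo.
  by move=> yab; rewrite ifT.
apply: (@near_eq_is_derive _ _ _ (cst 0)).
have : nbhs x (~` `[a, b]%classic).
  by apply: open_nbhs_nbhs; split; [exact/closed_openC/itv_closed|exact/negP].
by apply: filterS => y /= /negP yNab; rewrite ifN.
Unshelve. all: by end_near. Qed.

Lemma trunc_bounded a b g :
  continuous g -> exists M, forall x, `|trunc a b g x| <= M.
Proof.
move=> cg; have [ab|ba] := leP a b; last first.
  by exists 0 => x; rewrite /trunc itv_ge ?bnd_simp -?ltNge// normr0.
have [|c _ gc] := @EVT_max R (fun x => `|g x|) a b ab.
  apply: continuous_subspaceT => x.
  apply: (@continuous_comp _ _ _ g Num.norm); first exact: cg.
  exact: norm_continuous.
exists `|g c| => x; rewrite /trunc.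
by case: ifPn => [/gc//|_]; rewrite normr0.
Qed.

End Truncation.

Lemma is_derive_bounded_lipschitz (R : realType) (f df : R -> R) (M : R) :
  (forall x, is_derive x (1 : R) f (df x)) -> (forall x, `|df x| <= M) ->
  M.-lipschitz f.
Proof.
move=> fdf dfM [x y] _ /=.
wlog xy : x y / x <= y.
  move=> wl; have [/wl//|/ltW/wl] := leP x y.
  by rewrite distrC [`|y - x|]distrC.
have [c _ fE] : exists2 c, c \in `[x, y] & f y - f x = df c * (y - x).
  apply: MVT_segment => //.
  apply: continuous_subspaceT => z.
  by apply/differentiable_continuous/derivable1_diffP/ex_derive.
by rewrite distrC fE normrM [`|x - y|]distrC ler_wpM2r.
Qed.

(** * The piecewise function as a finite sum of truncations *)

Section BumpFunction.
Context {R : realType} {J : nat} (s : 'I_J.+1 -> R) (Delta : R).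
Hypothesis disj : trivIset setT
  (fun j : 'I_J.+1 => `[s j - Delta, s j + Delta]%classic).
Implicit Type P : 'I_J.+1 -> {poly R}.

Lemma bump_fun_itv P j x :
  x \in `[s j - Delta, s j + Delta] -> bump_fun s Delta P x = (P j).[x].
Proof.
move=> xj; rewrite /bump_fun; case: pickP => [i xi|/(_ j)]; last by rewrite xj.
by rewrite (@disj i j)//; exists x.
Qed.

(** At most one summand is nonzero at x, by disjointness.  The sum form lets
    differentiation and bounds be done one interval at a time, with no
    discussion of how a neighbourhood of x meets the other intervals. *)
Lemma bump_funE P x :
  bump_fun s Delta P x =
  \sum_j trunc (s j - Delta) (s j + Delta) (horner (P j)) x.
Proof.
have [[j xj]|xN] := pselect (exists j, x \in `[s j - Delta, s j + Delta]).
  rewrite (bump_fun_itv P xj) (bigD1 j)//= big1 ?addr0 /trunc ?xj// => i ij.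
  case: ifPn => // xi; case/eqP: ij.
  by apply: disj => //; exists x.
rewrite big1 /bump_fun; last first.
  by move=> j _; rewrite /trunc ifF//; apply/negP => xj; apply: xN; exists j.
by case: pickP => // j xj; case: xN; exists j.
Qed.

(** The derivative is again of the same form, so the lemma can be iterated. *)
Lemma is_derive_bump_fun P x :
  (forall j, [/\ (P j).[s j - Delta] = 0, (P j).[s j + Delta] = 0,
    (P j)^`().[s j - Delta] = 0 & (P j)^`().[s j + Delta] = 0]) ->
  is_derive x (1 : R) (bump_fun s Delta P)
    (bump_fun s Delta (fun j => (P j)^`()) x).
Proof.
move=> P0; rewrite bump_funE.
have -> : bump_fun s Delta P =
    \sum_j trunc (s j - Delta) (s j + Delta) (horner (P j)).
  by apply/funext => y; rewrite bump_funE fct_sumE.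
apply: is_derive_sum => j.
have [? ? ? ?] := P0 j.
exact: is_derive_trunc.
Qed.

Lemma bump_fun_bounded P : exists M, forall x, `|bump_fun s Delta P x| <= M.
Proof.
have tb j : {M | forall x,
    `|trunc (s j - Delta) (s j + Delta) (horner (P j)) x| <= M}.
  by apply/cid/trunc_bounded/continuous_horner.
exists (\sum_j sval (tb j)) => x.
rewrite bump_funE (le_trans (ler_norm_sum _ _ _))//.
by apply: ler_sum => j _; exact: (svalP (tb j)).
Qed.

End BumpFunction.

Theorem proposition4p2 (R : realType) (J : nat) (hJ : (1 <= J)%N)
    (s : 'I_J.+1 -> R)
    (s_incr : forall i j : 'I_J.+1, (i < j)%N -> s i < s j)
    (Delta : R) (Delta_gt0 : 0 < Delta)
    (disj : trivIset setT
              (fun j : 'I_J.+1 => `[s j - Delta, s j + Delta]%classic))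
    (f f1 f2 : 'I_J.+1 -> R) :
  (forall j, exists p : {poly R}, bump_poly (s j) Delta (f j) (f1 j) (f2 j) p)
  /\
  (forall P : 'I_J.+1 -> {poly R},
     (forall j, bump_poly (s j) Delta (f j) (f1 j) (f2 j) (P j)) ->
     let F := bump_fun s Delta P in
     [/\ forall j, jet2 F (s j) (f j) (f1 j) (f2 j),
         forall j, jet2 F (s j - Delta) 0 0 0 /\ jet2 F (s j + Delta) 0 0 0
       & [/\ has_lbound (range F),
             forall theta : R, derivable F theta 1
           & [locally [lipschitz F^`()%classic theta | theta in setT]]]]).
Proof.
split=> [j|P bP F]; first exact: bump_poly_exists.
have in_l j : s j - Delta \in `[s j - Delta, s j + Delta].
  by rewrite in_itv/=; lra.
have in_r j : s j + Delta \in `[s j - Delta, s j + Delta].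
  by rewrite in_itv/=; lra.
have in_c j : s j \in `[s j - Delta, s j + Delta].
  by rewrite in_itv/=; lra.
have F_dF x : is_derive x (1 : R) F (bump_fun s Delta (fun j => (P j)^`()) x).
  apply: is_derive_bump_fun => // j.
  by have [_ /jet2_hornerP[? ? _] /jet2_hornerP[? ? _] _] := bP j.
have F1 : F^`()%classic = bump_fun s Delta (fun j => (P j)^`()).
  by apply/funext => x; rewrite derive1E derive_val.
have F1_d2F x :
    is_derive x (1 : R) F^`()%classic
      (bump_fun s Delta (fun j => (P j)^`()^`()) x).
  rewrite F1; apply: is_derive_bump_fun => // j.
  by have [_ /jet2_hornerP[_ ? ?] /jet2_hornerP[_ ? ?] _] := bP j.
have jet_F j x : x \in `[s j - Delta, s j + Delta] ->
    forall a b c, jet2 (horner (P j)) x a b c -> jet2 F x a b c.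
  move=> xj a b c /jet2_hornerP[<- <- <-].
  split; first exact: bump_fun_itv.
  - by rewrite -(bump_fun_itv disj (fun j => (P j)^`()) xj).
  - by rewrite -(bump_fun_itv disj (fun j => (P j)^`()^`()) xj).
split.
- by move=> j; have [_ _ _] := bP j; exact: (jet_F _ _ (in_c j)).
- by move=> j; have [_ bl br _] := bP j; split;
    [exact: (jet_F _ _ (in_l j))|exact: (jet_F _ _ (in_r j))].
- split.
  + have [M FM] := bump_fun_bounded disj P.
    by exists (- M) => _ [x _ <-]; have := FM x; rewrite ler_norml => /andP[].
  + by move=> x; exact: ex_derive.
  + have [M d2FM] := bump_fun_bounded disj (fun j => (P j)^`()^`()).
    apply: lipschitz_locally.
    apply: (@klipschitzW _ _ _ M).
      exact: (@globally_properfilter _ _ (0, 0)).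
    exact: is_derive_bounded_lipschitz F1_d2F d2FM.
Qed.
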